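(* Let $V$ be a finite-dimensional real vector space, $\Phi\subset V$ a reduced root system with base $\Delta$, and $I$ a finite group of linear automorphisms of $V$ preserving $\Phi$ and $\Delta$. Let $\Phi^\vee\supset\Delta^\vee$ be the dual based root system, with the induced action of $I$. Then the based root system $(V_I,\mathrm{res}_I(\Phi^\vee),\mathrm{res}_I(\Delta^\vee))$ is dual to $(V^I,N'_I(\Phi),N'_I(\Delta))$, and the based root system $(V_I,\mathrm{res}'_I(\Phi^\vee),\mathrm{res}'_I(\Delta^\vee))$ is dual to $(V^I,N_I(\Phi),N_I(\Delta))$. That is, via the averaging isomorphism $V_I\cong V^I$, $$\mathrm{res}_I(\Phi^\vee)^\vee=N'_I(\Phi),\qquad \mathrm{res}'_I(\Phi^\vee)^\vee=N_I(\Phi),$$ compatibly with the indicated bases.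
   Context: The root system $\Phi$ is not required to span $V$. Fix a positive definite symmetric bilinear form $(\cdot\,|\,\cdot)$ on $V$ invariant under $W\rtimes I$, where $W$ is the Weyl group of $\Phi$, generated by the reflections $s_\alpha(v)=v-\frac{2(\alpha|v)}{(\alpha|\alpha)}\alpha$; use it to identify $V$ with its dual. For $v\in V\setminus\{0\}$ put $v^\vee:=\frac{2v}{(v|v)}$; the dual of a root system $R$ is $R^\vee=\{a^\vee: a\in R\}$ (so $\Phi^\vee=\{\alpha^\vee\}$, $\Delta^\vee=\{\alpha^\vee:\alpha\in\Delta\}$). $V^I$ denotes invariants and $V_I$ coinvariants; they are identified by the averaging isomorphism $V_I\to V^I$ sending the class $\bar v$ of $v\in V$ to the average $v^\diamond$ of the $I$-orbit $Iv$, and duals in $V_I\cong V^I$ are taken with respect to the restriction of $(\cdot\,|\,\cdot)$ to $V^I$. $I$ acts on $W$ by conjugation, and $W^I$ (the fixed subgroup) acts on $V^I$ and $V_I$. For a reduced root system $\Phi\subset V$ with base $\Delta$, where the finite group $I$ acts on $V$ by linear automorphisms preserving $\Phi$ and $\Delta$, and for $\alpha\in\Delta$, define: - $N_I(\alpha):=\sum_{\alpha'\in I\alpha}\alpha'\in V^I$ (sum over the orbit); - $\mathrm{res}_I(\alpha):=\bar\alpha\in V_I$; - $N'_I(\alpha):=N_I(\alpha)$ if the elements of $I\alpha$ are pairwise orthogonal, and $N'_I(\alpha):=2N_I(\alpha)$ otherwise; - $\mathrm{res}'_I(\alpha):=\mathrm{res}_I(\alpha)$ if the elements of $I\alpha$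 are pairwise orthogonal, and $\mathrm{res}'_I(\alpha):=2\,\mathrm{res}_I(\alpha)$ otherwise. For $f\in\{N_I,N'_I,\mathrm{res}_I,\mathrm{res}'_I\}$ put $f(\Delta)=\{f(\alpha):\alpha\in\Delta\}$ and $f(\Phi):=W^I f(\Delta)$. These are reduced root systems with base $f(\Delta)$ and Weyl group $W^I$. The same definitions are applied to $(\Phi^\vee,\Delta^\vee)$. *)

(* Defs.v *)
From HB Require Import structures.
From mathcomp Require Import fingroup.
From mathcomp Require Import all_boot all_order all_algebra.
From mathcomp Require Import boolp classical_sets cardinality reals.
From mathcomp Require Import ring lra.

Set Implicit Arguments.
Unset Strict Implicit.
Unset Printing Implicit Defensive.

Import Order.TTheory GRing.Theory Num.Theory.

Local Open Scope classical_set_scope.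
Local Open Scope quotient_scope.
Local Open Scope ring_scope.

Section RootSystems.
Variables (R : realType) (V : vectType R) (form : {dot V for idfun}).
Implicit Types (u v a b : V) (Phi Delta : set V) (w : 'End(V)).
Local Notation "''[' u , v ]" := (form u v).

Definition dual_vec v : V := (2 / '[v, v]) *: v.

Definition refl_fun a v : V := v - (2 * '[a, v] / '[a, a]) *: a.

Definition reflection a : 'End(V) := linfun (refl_fun a).

Lemma refl_fun_is_linear a : linear (refl_fun a).
Proof.
move=> c x y; rewrite /refl_fun linearPr /= scalerBr addrACA -opprD.
by rewrite scalerA -scalerDl mulrDr mulrDl !mulrA (mulrC 2 c).
Qed.

HB.instance Definition _ a :=
  GRing.isLinear.Build R V V _ (refl_fun a) (refl_fun_is_linear a).

Lemma reflectionE a v : reflection a v = refl_fun a v.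
Proof. exact: lfunE. Qed.

(* The span of [Phi] may be a proper subspace of [V]. *)
Definition is_root_system Phi : Prop :=
  [/\ finite_set Phi,
      ~ Phi 0,
      forall a, Phi a -> reflection a @` Phi = Phi
    & forall a b, Phi a -> Phi b -> 2 * '[a, b] / '[a, a] \is a Num.int].

Definition is_reduced Phi : Prop :=
  forall a (c : R), Phi a -> Phi (c *: a) -> c = 1 \/ c = -1.

Definition is_base Phi Delta : Prop :=
  Delta `<=` Phi /\
  exists s : seq V, [/\ free s, Delta = [set` s]
    & forall a, Phi a -> exists c : V -> nat,
        a = \sum_(b <- s) b *+ c b \/ a = - \sum_(b <- s) b *+ c b].

(* Reflections are involutions, so closing under products suffices. *)
Inductive weyl Phi : set 'End(V) :=
| weyl1 : weyl Phi \1%VF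
| weylM a w : Phi a -> weyl Phi w -> weyl Phi (reflection a \o w)%VF.

Lemma formC u v : '[u, v] = '[v, u].
Proof. by rewrite (hermitian_subproof u v) expr0 mul1r. Qed.

(* Invariance of the form under the Weyl group need not be assumed. *)
Lemma weyl_isometry Phi w u v : weyl Phi w -> '[w u, w v] = '[u, v].
Proof.
move=> Ww; elim: Ww u v => [|a {}w _ _ IH] u v; first by rewrite !lfunE.
rewrite !comp_lfunE !reflectionE -[RHS]IH.
move: (w u) (w v) => x y; rewrite /refl_fun.
have [->|a0] := eqVneq a 0; first by rewrite !scaler0 !subr0.
have aa0 : '[a, a] != 0 by rewrite gt_eqF// neq0_dnorm_gt0.
rewrite linearBl !linearBr /= !linearZl_LR /= !linearZr_LR /= (formC x a).
by field.
Qed.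

End RootSystems.

Section Invariants.
Variables (R : realType) (V : vectType R).
Variables (gT : finGroupType) (rho : gT -> 'End(V)).
Implicit Types (u v a : V).

Definition is_linear_action : Prop :=
  rho 1%g = \1%VF /\ forall g h : gT, rho (g * h)%g = (rho g \o rho h)%VF.

Definition invariants : {vspace V} := (\bigcap_(g : gT) fixedSpace (rho g))%VS.

Definition coinv_ker : {vspace V} :=
  (\sum_(g : gT) limg (rho g - \1)%VF)%VS.

Definition coinvariants : Type := Quotient.quot (pred_of_vspace coinv_ker).


HB.instance Definition _ := GRing.Zmodule.on coinvariants.
HB.instance Definition _ := EqQuotient.on coinvariants.

Definition coinv_class (v : V) : coinvariants := \pi v.

Lemma eq_coinv u v : (coinv_class u = coinv_class v) <-> u - v \in coinv_ker.
Proof.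
rewrite /coinv_class; split=> [/eqP|uv]; first by rewrite -Quotient.idealrBE.
by apply/eqP; rewrite -Quotient.idealrBE.
Qed.


Lemma coinv_classK (x : coinvariants) : coinv_class (repr x) = x.
Proof. exact: reprK. Qed.

Lemma coinv_classD u v : coinv_class (u + v) = coinv_class u + coinv_class v.
Proof. exact: (raddfD (\pi_(Quotient.quot (pred_of_vspace coinv_ker)))). Qed.

Definition coinv_scale (c : R) (x : coinvariants) : coinvariants :=
  coinv_class (c *: repr x).

Lemma coinv_scaleE c v : coinv_scale c (coinv_class v) = coinv_class (c *: v).
Proof.
by apply/eq_coinv; rewrite -scalerBr memvZ//; apply/eq_coinv; rewrite coinv_classK.
Qed.

Fact coinv_scaleA c d x : coinv_scale c (coinv_scale d x) = coinv_scale (c * d) x.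
Proof. by rewrite -[x]coinv_classK !coinv_scaleE scalerA. Qed.
Fact coinv_scale1 : left_id 1 coinv_scale.
Proof. by move=> x; rewrite -[x]coinv_classK coinv_scaleE scale1r. Qed.
Fact coinv_scaleDr : right_distributive coinv_scale +%R.
Proof.
move=> c x y; rewrite -[x]coinv_classK -[y]coinv_classK -coinv_classD.
by rewrite !coinv_scaleE scalerDr coinv_classD.
Qed.
Fact coinv_scaleDl x : {morph coinv_scale^~ x : c d / c + d}.
Proof.
by move=> c d; rewrite -[x]coinv_classK !coinv_scaleE scalerDl coinv_classD.
Qed.

HB.instance Definition _ := GRing.Zmodule_isLmodule.Build R coinvariants
  coinv_scaleA coinv_scale1 coinv_scaleDr coinv_scaleDl.

Fact coinv_class_is_linear : linear coinv_class.
Proof. by move=> c u v; rewrite coinv_classD -coinv_scaleE. Qed.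

HB.instance Definition _ :=
  GRing.isLinear.Build R V coinvariants _ coinv_class coinv_class_is_linear.

Definition Iorbit v : seq V := undup [seq rho g v | g <- enum gT].

Definition orbit_avg v : V :=
  (size (Iorbit v))%:R^-1 *: \sum_(u <- Iorbit v) u.

(* Independent of the representative, by [averagingE] below. *)
Definition averaging (x : coinvariants) : V := orbit_avg (repr x).

Section LinearAction.
Hypothesis act : is_linear_action.

Lemma act1 v : rho 1%g v = v.
Proof. by rewrite (proj1 act) lfunE. Qed.

Lemma actM g h v : rho (g * h)%g v = rho g (rho h v).
Proof. by rewrite (proj2 act) comp_lfunE. Qed.

Lemma actKV g : cancel (rho g^-1%g) (rho g).
Proof. by move=> v; rewrite -actM mulgV act1. Qed.

Lemma actK g : cancel (rho g) (rho g^-1%g).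
Proof. by move=> v; rewrite -actM mulVg act1. Qed.

Lemma IorbitP u v : reflect (exists g, u = rho g v) (u \in Iorbit v).
Proof.
rewrite mem_undup; apply: (iffP mapP) => [[g _ ->]|[g ->]]; first by exists g.
by exists g; rewrite // mem_enum.
Qed.

Lemma orbit_avgE v : orbit_avg v = (#|gT|%:R)^-1 *: \sum_(g : gT) rho g v.
Proof.
pose F u := #|[pred g | rho g v == u]|.
have FE u : u \in Iorbit v -> F u = F v.
  case/IorbitP => h ->; rewrite /F -!sum1_card.
  rewrite (reindex_inj (mulgI h)); apply: eq_bigl => g; rewrite !inE actM.
  by rewrite (can_eq (actK h)).
have F0 : (0 < F v)%N.
  by apply/card_gt0P; exists 1%g; rewrite inE act1.
have part (M : nmodType) (f : V -> M) :
    \sum_(g : gT) f (rho g v) = \sum_(u <- Iorbit v) f u *+ F v.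
  have -> : \sum_(g : gT) f (rho g v) =
      \sum_(u <- [seq rho g v | g <- enum gT]) f u by rewrite big_map big_enum.
  rewrite -big_undup_iterop_count !big_seq; apply: eq_bigr => u /FE <-.
  rewrite count_map Monoid.iteropE iter_addr addr0 /F; congr (_ *+ _).
  by rewrite cardE [in RHS]/enum_mem size_filter -enumT; apply: eq_count.
have cardG : #|gT| = (size (Iorbit v) * F v)%N.
  have := part nat (fun=> 1%N); rewrite sum1_card => ->.
  have natM (m n : nat) : m *+ n = (m * n)%N.
    by elim: n => [|n IH]; rewrite ?muln0// mulrS IH mulnS.
  by rewrite big_const_seq count_predT iter_addr addr0 !natM mul1n mulnC.
rewrite /orbit_avg (part V id) sumrMnl cardG natrM invfM -scaler_nat scalerA.
by rewrite -mulrA mulVf ?mulr1// pnatr_eq0 -lt0n.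
Qed.

Fact orbit_avg_is_linear : linear orbit_avg.
Proof.
move=> c u v; rewrite !orbit_avgE scalerA (mulrC c) -scalerA -scalerDr.
congr (_ *: _); rewrite scaler_sumr -big_split.
by apply: eq_bigr => g _; rewrite linearP.
Qed.

Lemma orbit_avg_act g v : orbit_avg (rho g v) = orbit_avg v.
Proof.
rewrite !orbit_avgE; congr (_ *: _).
by rewrite [RHS](reindex_inj (mulIg g)); apply: eq_bigr => h _; rewrite actM.
Qed.

Lemma orbit_avg_ker v : v \in coinv_ker -> orbit_avg v = 0.
Proof.
pose f : {linear V -> V} := 
  HB.pack orbit_avg (GRing.isLinear.Build _ _ _ _ _ orbit_avg_is_linear).
case/memv_sumP => vs vsP ->; rewrite -[orbit_avg]/(f : V -> V) raddf_sum big1// => g _.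
have /memv_imgP[u _ ->] := vsP g isT.
by rewrite add_lfunE opp_lfunE id_lfunE raddfB /= orbit_avg_act subrr.
Qed.

Lemma averagingE v : averaging (coinv_class v) = orbit_avg v.
Proof.
apply/eqP; rewrite -subr_eq0 -scaleN1r addrC -orbit_avg_is_linear scaleN1r.
by rewrite addrC orbit_avg_ker//; apply/eq_coinv; rewrite coinv_classK.
Qed.

Lemma invariantsP v : reflect (forall g, rho g v = v) (v \in invariants).
Proof.
apply: (iffP idP) => [vI g|vI].
  apply/fixedSpaceP; apply: subvP vI; exact: bigcapv_inf.
by rewrite memvE; apply/subv_bigcapP => g _; apply/fixedSpaceP.
Qed.

Lemma averaging_invariant x : averaging x \in invariants.
Proof.
apply/invariantsP => g; rewrite /averaging orbit_avgE linearZ linear_sum /=.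
congr (_ *: _); rewrite [RHS](reindex_inj (mulgI g)).
by apply: eq_bigr => h _; rewrite actM.
Qed.

Lemma averaging_id v : v \in invariants -> averaging (coinv_class v) = v.
Proof.
move/invariantsP => vI; rewrite averagingE orbit_avgE.
under eq_bigr do rewrite vI.
rewrite sumr_const cardT -scaler_nat scalerA mulVf ?scale1r//.
by rewrite pnatr_eq0 -cardT -lt0n; apply/card_gt0P; exists 1%g.
Qed.

Lemma coinv_class_act g v : coinv_class (rho g v) = coinv_class v.
Proof.
apply/eq_coinv; apply: (subvP (sumv_sup g _ (subvv _))) => //.
have -> : rho g v - v = (rho g - \1)%VF v.
  by rewrite add_lfunE opp_lfunE id_lfunE.
exact: memv_img (memvf v).
Qed.

Lemma averagingK x : coinv_class (averaging x) = x.
Proof.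
rewrite -{2}[x]coinv_classK /averaging orbit_avgE linearZ linear_sum /=.
under eq_bigr do rewrite coinv_class_act.
rewrite sumr_const cardT -scaler_nat scalerA mulVf ?scale1r//.
by rewrite pnatr_eq0 -cardT -lt0n; apply/card_gt0P; exists 1%g.
Qed.

End LinearAction.

(* The action on coinvariants of a [w] commuting with every [rho g]. *)
Definition coinv_act (w : 'End(V)) (x : coinvariants) : coinvariants :=
  coinv_class (w (repr x)).

Lemma coinv_actE (w : 'End(V)) v :
  (forall g, (rho g \o w)%VF = (w \o rho g)%VF) ->
  coinv_act w (coinv_class v) = coinv_class (w v).
Proof.
move=> wC; apply/eq_coinv; rewrite -linearB /=.
have : repr (coinv_class v) - v \in coinv_ker.
  by apply/eq_coinv; rewrite coinv_classK.
case/memv_sumP => vs vsP ->; rewrite linear_sum.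
apply: memv_sumr => g _; have /memv_imgP[u _ ->] := vsP g isT.
rewrite add_lfunE opp_lfunE id_lfunE linearB /= -comp_lfunE -wC comp_lfunE.
have -> : rho g (w u) - w u = (rho g - \1)%VF (w u).
  by rewrite add_lfunE opp_lfunE id_lfunE.
exact: memv_img (memvf _).
Qed.

End Invariants.

Section Folding.
Variables (R : realType) (V : vectType R) (form : {dot V for idfun}).
Variables (gT : finGroupType) (rho : gT -> 'End(V)).
Implicit Types (a : V) (Phi X : set V) (Y : set (coinvariants rho)).

Definition preserves X : Prop := forall g, rho g @` X = X.

Definition form_invariant : Prop :=
  forall g u v, form (rho g u) (rho g v) = form u v.

Definition dual_set X : set V := dual_vec form @` X.

Definition weyl_fixed Phi : set 'End(V) :=
  [set w | weyl form Phi w /\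
           forall g, (rho g \o w \o rho g^-1%g)%VF = w].

Definition orthogonal_orbit a : bool :=
  all2rel (fun b c => (b == c) || (form b c == 0)) (Iorbit rho a).

Definition N a : V := \sum_(b <- Iorbit rho a) b.

Definition N' a : V := if orthogonal_orbit a then N a else 2 *: N a.

Definition res a : coinvariants rho := coinv_class rho a.

Definition res' a : coinvariants rho :=
  if orthogonal_orbit a then res a else 2 *: res a.

Definition weyl_fixed_orbit Phi X : set V :=
  [set w v | w in weyl_fixed Phi & v in X].

Definition weyl_fixed_orbit_coinv Phi Y : set (coinvariants rho) :=
  [set coinv_act w y | w in weyl_fixed Phi & y in Y].

(* The dual of a subset of the coinvariants, computed in the invariants through
   the averaging isomorphism and the restricted form. *)
Definition dual_coinv Y : set V := dual_set (@averaging _ _ _ rho @` Y).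

End Folding.

(* Main.v *)
(** For a simple root [a] with orbit sum [s = N a] of [n] terms, the dual of the
    average of the orbit of the coroot is [(n (a|a) / (s|s)) s], and [(s|s) = n (a|s)].
    Distinct simple roots are at obtuse angles, so [(a|s) = (a|a) (1 - k/2)] with
    [k] a natural number; as [s <> 0], positivity forces [k <= 1].  The case
    [k = 0] is that of an orthogonal orbit, and [k = 1] yields the factor 2. *)

Require Import Defs.
From HB Require Import structures.
From mathcomp Require Import fingroup.
From mathcomp Require Import all_boot all_order all_algebra.
From mathcomp Require Import boolp classical_sets cardinality reals.
From mathcomp Require Import zify ring lra.

Set Implicit Arguments.
Unset Strict Implicit.
Unset Printing Implicit Defensive.

Import Order.TTheory GRing.Theory Num.Theory.

Local Open Scope classical_set_scope.
Local Open Scope ring_scope.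

(** * Dual vectors, their reflections, and angles between simple roots *)

Section Dual.
Variables (R : realType) (V : vectType R) (form : {dot V for idfun}).
Implicit Types (u v a b : V) (Phi : set V) (w : 'End(V)).
Local Notation "''[' u , v ]" := (form u v).

Lemma dual_vecZ c v : dual_vec form (c *: v) = c^-1 *: dual_vec form v.
Proof.
rewrite /dual_vec linearZl_LR linearZr_LR /= !scalerA; congr (_ *: _).
have [->|c0] := eqVneq c 0; first by rewrite mulr0 invr0 mul0r.
(* The inverse of ['[v, v]] is made opaque, so [field] asks only for [c != 0] and the case [v = 0]
   is covered too. *)
by rewrite !invfM; move: ('[v, v]^-1) => d; field.
Qed.

Lemma dual_vec_isometry w v :
  '[w v, w v] = '[v, v] -> dual_vec form (w v) = w (dual_vec form v).
Proof. by move=> wI; rewrite /dual_vec wI linearZ. Qed.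

(** A reflection depends only on the line spanned by its root, and [dual_vec] only rescales. *)
Lemma reflection_dual a : reflection form (dual_vec form a) = reflection form a.
Proof.
apply/lfunP => v; rewrite !reflectionE /refl_fun /dual_vec.
have [->|a0] := eqVneq a 0; first by rewrite !scaler0.
have aa0 : '[a, a] != 0 by rewrite gt_eqF// neq0_dnorm_gt0.
rewrite !linearZl_LR /= !linearZr_LR /= scalerA; congr (_ - _ *: _).
by field.
Qed.

(** Both groups are generated by the same reflections; hence one fixed subgroup acts on both sides
    of the duality. *)
Lemma weyl_dual Phi : weyl form (dual_set form Phi) = weyl form Phi.
Proof.
apply/seteqP; split=> w; elim=> [|a {}w]; try exact: weyl1.
  by move=> [b Pb <-] _ IH; rewrite reflection_dual; exact: weylM.
move=> Pa _ IH; rewrite -reflection_dual; apply: weylM => //.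
by exists a.
Qed.

(** If ['[a, b]] were positive, reflecting [b] in [a] would give a root [b - k *: a] with [k > 0],
    whose coordinates in the base have mixed signs. *)
Lemma simple_roots_obtuse Phi (Delta : set V) a b :
  is_root_system form Phi -> is_base Phi Delta ->
  Delta a -> Delta b -> a != b -> '[a, b] <= 0.
Proof.
move=> [_ Phi0 refl _] [sub [s [fs Ds coef]]] Da Db ab.
rewrite leNgt; apply/negP => ab_gt0.
have aa_gt0 : 0 < '[a, a].
  rewrite neq0_dnorm_gt0//; apply/eqP => a0; apply: Phi0.
  by rewrite -a0; exact: sub.
have : Phi (refl_fun form a b).
  by rewrite -reflectionE -(refl a (sub _ Da)); exists b => //; exact: sub.
rewrite /refl_fun; set k := 2 * _ / _.
have k_gt0 : 0 < k by rewrite divr_gt0// mulr_gt0.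
move=> /coef[c].
have [sa sb] : a \in s /\ b \in s by move: Da Db; rewrite Ds.
have [lta ltb] : (index a s < size s /\ index b s < size s)%N.
  by rewrite !index_mem.
pose i := Ordinal lta; pose j := Ordinal ltb.
have fT : free (in_tuple s) by [].
have ji : (i == j) = false.
  apply/negP => /eqP/(congr1 val)/= ij; case/eqP: ab.
  by rewrite -(nth_index 0 sa) ij nth_index.
have cs l : coord (in_tuple s) l (\sum_(d <- s) d *+ c d) = (c s`_l)%:R.
  rewrite (big_nth 0) big_mkord linear_sum (bigD1 l)//= big1 ?addr0.
    by rewrite linearMn /= (coord_free l l fT) eqxx.
  by move=> m ml; rewrite linearMn /= (coord_free m l fT) (negbTE ml) mul0rn.
have ca l : coord (in_tuple s) l a = (l == i)%:R.
  by rewrite -{1}(nth_index 0 sa) (coord_free i l fT) eq_sym.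
have cb l : coord (in_tuple s) l b = (l == j)%:R.
  by rewrite -{1}(nth_index 0 sb) (coord_free j l fT) eq_sym.
(* Nonnegative coefficients are refuted by the coordinate [- k] at [a], nonpositive ones by the
   coordinate 1 at [b]. *)
case=> E.
  move/(congr1 (coord (in_tuple s) i)): E.
  rewrite cs linearB linearZ /= ca cb eqxx ji /GRing.scale /=.
  by have := ler0n R (c s`_i); lra.
move/(congr1 (coord (in_tuple s) j)): E.
rewrite linearN /= cs linearB linearZ /= ca cb eqxx eq_sym ji /GRing.scale /=.
by have := ler0n R (c s`_j); lra.
Qed.

End Dual.

(** * Orbits of simple roots and their sums *)

Section Orbits.
Variables (R : realType) (V : vectType R) (form : {dot V for idfun}).
Variables (gT : finGroupType) (rho : gT -> 'End(V)).
Hypotheses (hact : is_linear_action rho) (hform : form_invariant form rho).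
Implicit Types (u v a b : V) (Phi Delta : set V) (w : 'End(V)).
Local Notation "''[' u , v ]" := (form u v).

Lemma IorbitZ c v : c != 0 -> Iorbit rho (c *: v) = map ( *:%R c) (Iorbit rho v).
Proof.
move=> c0; rewrite /Iorbit -undup_map_inj; last exact: scalerI.
by rewrite -[in RHS]map_comp; congr undup; apply: eq_map => g /=; rewrite linearZ.
Qed.

(** A coroot is a nonzero multiple of its root, so [N'] of the root and [res'] of the coroot take
    the same branch. *)
Lemma orthogonal_orbitZ c v :
  c != 0 -> orthogonal_orbit form rho (c *: v) = orthogonal_orbit form rho v.
Proof.
move=> c0; rewrite /orthogonal_orbit IorbitZ// allrel_mapl allrel_mapr.
apply: eq_allrel => x y /=.
by rewrite (inj_eq (scalerI c0)) linearZl_LR linearZr_LR /= !mulf_eq0 (negbTE c0).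
Qed.

Lemma mem_Iorbit v : v \in Iorbit rho v.
Proof. by apply/IorbitP; exists 1%g; rewrite (act1 hact). Qed.

Lemma size_Iorbit_neq0 v : (size (Iorbit rho v))%:R != 0 :> R.
Proof. by rewrite pnatr_eq0; case: Iorbit (mem_Iorbit v). Qed.

(** The action is isometric and transitive on the orbit, so any pair can be moved to one whose first
    entry is [a]. *)
Lemma orthogonal_orbitP a :
  reflect {in Iorbit rho a, forall b, b != a -> '[a, b] = 0}
          (orthogonal_orbit form rho a).
Proof.
rewrite /orthogonal_orbit; apply: (iffP allrelP) => [h b bO ba|h x y].
  by have := h _ _ (mem_Iorbit a) bO; rewrite eq_sym (negbTE ba) => /eqP.
move=> /IorbitP[g ->] /IorbitP[k ->].
have [//|ne /=] := eqVneq.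
have -> : rho k a = rho g (rho (g^-1 * k)%g a) by rewrite -(actM hact) mulKVg.
rewrite hform h//; first by apply/IorbitP; eexists.
by apply: contraNneq ne => E; rewrite -{1}E -(actM hact) mulKVg.
Qed.

Lemma orbit_avgZ c v : orbit_avg rho (c *: v) = c *: orbit_avg rho v.
Proof.
have := orbit_avg_is_linear hact c v 0; rewrite addr0 => ->.
by rewrite [orbit_avg rho 0]orbit_avg_ker ?addr0// mem0v.
Qed.

Lemma orbit_avg_N a : orbit_avg rho a = (size (Iorbit rho a))%:R^-1 *: N rho a.
Proof. by []. Qed.

Lemma N_orbit_avg a : N rho a = (size (Iorbit rho a))%:R *: orbit_avg rho a.
Proof. by rewrite orbit_avg_N scalerA mulfV ?scale1r// size_Iorbit_neq0. Qed.

Lemma rho_N g a : rho g (N rho a) = N rho a.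
Proof.
rewrite N_orbit_avg linearZ /= -(averagingE hact); congr (_ *: _).
exact/invariantsP/averaging_invariant.
Qed.

(** The orbit sum is invariant, so every element of the orbit pairs with it as [a] does. *)
Lemma form_N a : '[N rho a, N rho a] = (size (Iorbit rho a))%:R * '[a, N rho a].
Proof.
rewrite [X in '[X, _]]/N linear_sumlz /=.
rewrite (eq_big_seq (fun=> '[a, N rho a])); last first.
  by move=> u /IorbitP[g ->]; rewrite -{1}(rho_N g a) hform.
by rewrite big_const_seq count_predT iter_addr addr0 mulr_natl.
Qed.

(** The orbit is part of the base, hence free, and the orbit sum is the combination with all
    coefficients 1. *)
Lemma N_neq0 Phi Delta a :
  is_base Phi Delta -> preserves rho Delta -> Delta a -> N rho a != 0.
Proof.
move=> [_ [s [fs Ds _]]] pres Da.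
have Os : {subset Iorbit rho a <= s}.
  move=> b /IorbitP[g ->].
  have : Delta (rho g a) by rewrite -(pres g); exists a.
  by rewrite Ds.
have fO : free (Iorbit rho a).
  rewrite (perm_free (_ : perm_eq _ [seq b <- s | b \in Iorbit rho a])).
    exact: filter_free.
  apply: uniq_perm; rewrite ?undup_uniq ?filter_uniq ?free_uniq// => b.
  by rewrite mem_filter; case: (boolP (b \in _)) => // /Os ->.
apply/eqP => N0.
have /freeP/(_ (fun=> 1))/= f1 : free (in_tuple (Iorbit rho a)) by [].
have ltO : (index a (Iorbit rho a) < size (Iorbit rho a))%N.
  by rewrite index_mem mem_Iorbit.
suff /f1/(_ (Ordinal ltO))/eqP :
    \sum_(i < size (Iorbit rho a)) 1 *: (Iorbit rho a)`_i = 0.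
  by rewrite oner_eq0.
rewrite -[RHS]N0 /N [RHS](big_nth 0) big_mkord.
by apply: eq_bigr => i _; rewrite scale1r.
Qed.

Lemma form_simple_N Phi Delta a :
  is_root_system form Phi -> is_base Phi Delta -> preserves rho Delta ->
  Delta a ->
  '[a, N rho a] = (if orthogonal_orbit form rho a then 1 else 2^-1) * '[a, a].
Proof.
move=> rs base pres Da.
have sub := proj1 base.
have aa_gt0 : 0 < '[a, a].
  rewrite neq0_dnorm_gt0//; apply/eqP => a0; case: rs => _ Phi0 _ _; apply: Phi0.
  by rewrite -a0; exact: sub.
have DO b : b \in Iorbit rho a -> Delta b.
  by case/IorbitP => g ->; rewrite -(pres g); exists a.
set O := Iorbit rho a.
have uO : uniq O by exact: undup_uniq.
have split_N : '[a, N rho a] = '[a, a] + \sum_(b <- O | b != a) '[a, b].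
  by rewrite linear_sum /= (bigD1_seq a) ?mem_Iorbit.
(* By [form_N], this is the positive number ['[N rho a, N rho a]] divided by the size of the
   orbit. *)
have pos : 0 < '[a, N rho a].
  have : 0 < '[N rho a, N rho a] by rewrite neq0_dnorm_gt0// (N_neq0 base).
  by rewrite form_N pmulr_rgt0// lt0r size_Iorbit_neq0 ler0n.
have obtuse b : b \in O -> b != a -> '[a, b] <= 0.
  move=> bO ba; apply: (simple_roots_obtuse rs base) => //; first exact: DO.
  by rewrite eq_sym.
set S := \sum_(b <- O | b != a) _ in split_N.
have S_le0 : S <= 0.
  by rewrite /S big_seq_cond; apply: sumr_le0 => b /andP[]; exact: obtuse.
(* A sum of Cartan integers [m]; then ['[a, N rho a]] is ['[a, a]] times [1 + m / 2], and its
   positivity leaves only [m = 0] and [m = -1]. *)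
have : 2 * S / '[a, a] \is a Num.int.
  rewrite mulr_sumr mulr_suml big_seq_cond; apply: rpred_sum => b /andP[bO _].
  by case: rs => _ _ _; apply; apply: sub => //; exact: DO.
case/intrP => m mE.
have SE : S = m%:~R * '[a, a] / 2 by rewrite -mE; field; rewrite gt_eqF.
have m_le0 : m <= 0.
  by rewrite -(ler_int R) -mE pmulr_lle0 ?invr_gt0// pmulr_rle0.
have m_gt : -2 < m.
  rewrite -(ltr_int R) -mE ltr_pdivlMr//; move: pos; rewrite split_N.
  by rewrite mulrNz; lra.
case: (orthogonal_orbitP a) => [orth|northo].
  by rewrite split_N mul1r /S big_seq_cond big1 ?addr0// => b /andP[]; exact: orth.
(* If [m = 0], the nonnegative terms [- '[a, b]] sum to zero, so each vanishes and the orbit is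
   orthogonal. *)
have m_neq0 : m != 0.
  apply/eqP => m0; apply: northo => b bO ba.
  have S0 : \sum_(b <- O | b != a) - '[a, b] = 0.
    by rewrite sumrN -/S SE m0 !mul0r oppr0.
  move/eqP: S0; rewrite big_seq_cond psumr_eq0; last first.
    by move=> d /andP[dO da]; rewrite oppr_ge0; exact: obtuse.
  by move/allP/(_ b bO); rewrite bO ba /= oppr_eq0 => /eqP.
have mN1 : m = -1 by lia.
by rewrite split_N SE mN1; field.
Qed.

(** * Duals of the restricted simple coroots *)

Lemma dual_avg_coroot Phi Delta a :
  is_root_system form Phi -> is_base Phi Delta -> preserves rho Delta ->
  Delta a -> dual_vec form (orbit_avg rho (dual_vec form a)) = N' form rho a.
Proof.
move=> rs base pres Da.
have aN := form_simple_N rs base pres Da.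
have NN0 : '[N rho a, N rho a] != 0.
  by rewrite gt_eqF// neq0_dnorm_gt0// (N_neq0 base).
have n0 := size_Iorbit_neq0 a.
have aa0 : '[a, a] != 0.
  by apply: contraNneq NN0 => aa0; rewrite form_N aN aa0 !mulr0.
rewrite {2}/dual_vec orbit_avgZ orbit_avg_N !dual_vecZ {1}/dual_vec.
rewrite !scalerA form_N aN.
(* The remaining coefficient of [N rho a] is the inverse of the factor in [form_simple_N], that is 1
   or 2. *)
rewrite /N'; case: ifP => _; last by congr (_ *: _); field; rewrite n0 aa0.
by rewrite -[RHS]scale1r; congr (_ *: _); field; rewrite n0 aa0.
Qed.

Lemma dual_res Phi Delta a :
  is_root_system form Phi -> is_base Phi Delta -> preserves rho Delta ->
  Delta a -> dual_vec form (averaging (res rho (dual_vec form a))) = N' form rho a.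
Proof.
by move=> rs base pres Da; rewrite (averagingE hact) (dual_avg_coroot rs base).
Qed.

(** For a non-orthogonal orbit, doubling the restricted coroot halves its dual, which cancels the
    factor 2 in [N']. *)
Lemma dual_res' Phi Delta a :
  is_root_system form Phi -> is_base Phi Delta -> preserves rho Delta ->
  Delta a -> dual_vec form (averaging (res' form rho (dual_vec form a))) = N rho a.
Proof.
move=> rs base pres Da; have := dual_res rs base pres Da.
have aa0 : 2 / '[a, a] != 0.
  rewrite mulf_neq0 ?pnatr_eq0// invr_eq0 gt_eqF// neq0_dnorm_gt0//.
  apply/eqP => a0; case: rs => _ Phi0 _ _; apply: Phi0.
  by rewrite -a0; exact: (proj1 base).
rewrite /res' /N' {2}/dual_vec orthogonal_orbitZ//; case: ifP => // _ E.
rewrite -linearZ /= (averagingE hact) orbit_avgZ dual_vecZ -(averagingE hact).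
by rewrite E scalerA mulVf ?scale1r// pnatr_eq0.
Qed.

(** * Equivariance under the fixed subgroup of the Weyl group *)

Lemma averaging_coinv_act w (x : coinvariants rho) :
  (forall g, (rho g \o w)%VF = (w \o rho g)%VF) ->
  averaging (coinv_act w x) = w (averaging x).
Proof.
move=> wC; rewrite -[x]coinv_classK (coinv_actE _ wC) !(averagingE hact).
rewrite !orbit_avgE// [RHS]linearZ [in RHS]linear_sum /=; congr (_ *: _).
by apply: eq_bigr => g _; rewrite -!comp_lfunE wC.
Qed.

Lemma weyl_fixed_commute Phi w g :
  weyl_fixed form rho Phi w -> (rho g \o w)%VF = (w \o rho g)%VF.
Proof.
case=> _ /(_ g) E; apply/lfunP => v; rewrite !comp_lfunE -{2}E !comp_lfunE.
by rewrite (actK hact).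
Qed.

(** Fixed Weyl elements commute with averaging and, being isometries, with [dual_vec]. Duality of
    the root systems thus reduces to duality of their bases. *)
Lemma dual_weyl_fixed_orbit_coinv Phi (Y : set (coinvariants rho)) :
  dual_coinv form (weyl_fixed_orbit_coinv form (dual_set form Phi) Y) =
  weyl_fixed_orbit form rho Phi (dual_coinv form Y).
Proof.
rewrite /weyl_fixed_orbit_coinv /weyl_fixed weyl_dual -/(weyl_fixed form rho Phi).
have E w (y : coinvariants rho) : weyl_fixed form rho Phi w ->
    dual_vec form (averaging (coinv_act w y)) = w (dual_vec form (averaging y)).
  move=> wP; rewrite averaging_coinv_act => [|g]; last exact: weyl_fixed_commute wP.
  by rewrite dual_vec_isometry// (weyl_isometry _ _ (proj1 wP)).
apply/seteqP; split=> v.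
  move=> [_ [_ [w wP [y Yy <-]] <-] <-]; rewrite E//.
  by exists w => //; exists (dual_vec form (averaging y)) => //;
    exists (averaging y) => //; exists y.
move=> [w wP [_ [_ [y Yy <-] <-] <-]]; rewrite -E//.
by exists (averaging (coinv_act w y)) => //; exists (coinv_act w y) => //;
  exists w => //; exists y.
Qed.

End Orbits.

Theorem theoremA (R : realType) (V : vectType R) (form : {dot V for idfun})
    (Phi Delta : set V) (gT : finGroupType) (rho : gT -> 'End(V))
    (hPhi : is_root_system form Phi) (hred : is_reduced Phi)
    (hDelta : is_base Phi Delta)
    (hact : is_linear_action rho)
    (hrhoPhi : preserves rho Phi) (hrhoDelta : preserves rho Delta)
    (hform : form_invariant form rho) :
  let PhiV := dual_set form Phi in
  let DeltaV := dual_set form Delta in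
  let resDeltaV := res rho @` DeltaV in
  let resPhiV := weyl_fixed_orbit_coinv form PhiV resDeltaV in
  let res'DeltaV := res' form rho @` DeltaV in
  let res'PhiV := weyl_fixed_orbit_coinv form PhiV res'DeltaV in
  let NDelta := N rho @` Delta in
  let NPhi := weyl_fixed_orbit form rho Phi NDelta in
  let N'Delta := N' form rho @` Delta in
  let N'Phi := weyl_fixed_orbit form rho Phi N'Delta in
  (dual_coinv form resPhiV = N'Phi /\ dual_coinv form resDeltaV = N'Delta) /\
  (dual_coinv form res'PhiV = NPhi /\ dual_coinv form res'DeltaV = NDelta).
Proof.
(* The bases are compared root by root; taking orbits under the fixed subgroup then gives the root
   systems. *)
have E : dual_coinv form (res rho @` dual_set form Delta) = N' form rho @` Delta.
  rewrite /dual_coinv /dual_set !image_comp; apply: eq_imagel => a Da /=.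
  exact: (dual_res hact hform hPhi hDelta).
have E' : dual_coinv form (res' form rho @` dual_set form Delta) = N rho @` Delta.
  rewrite /dual_coinv /dual_set !image_comp; apply: eq_imagel => a Da /=.
  exact: (dual_res' hact hform hPhi hDelta).
by do 2![split]; rewrite ?dual_weyl_fixed_orbit_coinv// ?E ?E'.
Qed.
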